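(* Let $R$ be a random subset of the cyclic group $C_n$ obtained by choosing each element of $C_n$ independently with probability $p=p(n)$, and let $N^R_{n-1-k,d}$ be the number of zero-sum free sequences of length $n-1-k$ having exactly $d$ distinct elements that are contained in $R$. Let $\varphi(n)$ denote the number of generators of $C_n$. (1) If $0\le k\le\lfloor n/3\rfloor$ and $p\gg\frac{\log\log n}{n}$, then for any function $\omega=\omega(n)$ tending to $\infty$ (arbitrarily slowly) as $n\to\infty$, asymptotically almost surely $$p\,\varphi(n)-\omega\sqrt{p\,\varphi(n)}\le N^R_{n-1-k,1}\le p\,\varphi(n)+\omega\sqrt{p\,\varphi(n)} .$$ (2) Let $d\ge2$ be an integer. If $k$ is fixed and $$p\gg\frac{(\log n)^2(\log\log n)^{1/d}}{n^{1/d}},$$ then asymptotically almost surely $$N^R_{n-1-k,d}=p^d\varphi(n)\left(\sum_{j=\frac{(d-1)d}{2}}^{k}q(j,d-1)\right)+O_k\left(\sqrt{p^d\varphi(n)}\,(\log n)^d\right),$$ where $q(j,d-1)$ is the number of partitions of $j$ having exactly $d-1$ distinct parts.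
   Context: $C_n$ is the cyclic group of order $n$, written additively. A sequence of length $\ell$ over $C_n$ is an unordered collection with repetition allowed (a multiset) $S=a_1\cdot a_2\cdot\ldots\cdot a_\ell$ of $\ell$ elements of $C_n$. A subsequence of $S$ is a sequence $T$ in which the multiplicity of each $a\in C_n$ is at most its multiplicity in $S$. $S$ is a zero-sum sequence if $a_1+\dots+a_\ell=0$, and $S$ is zero-sum free if it contains no (nonempty) zero-sum subsequence. $S$ is contained in $A\subset C_n$ if every element occurring in $S$ lies in $A$. A partition of a positive integer $j$ is a non-decreasing sequence of positive integers with sum $j$. For $j,d\ge1$, $q(j,d)$ is the number of partitions of $j$ in which exactly $d$ different part sizes occur (parts may be repeated). Empty sums are $0$. For functions of $n$, $f\ll g$ (equivalently $g\gg f$) means $f/g\to0$ as $n\to\infty$. ''Asymptotically almost surely'' means with probability tending to $1$ as $n\to\infty$; a statement ''a.a.s. $X=a+O_k(b)$'' means that there is a constant $c_k$ depending only on $k$ such that $\Pr[|X-a|\le c_k b]\to1$ as $n\to\infty$. *)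

(* Defs.v *)
From mathcomp Require Import all_boot all_order all_algebra all_fingroup.
From mathcomp Require Import cyclic.
From mathcomp Require Import all_classical all_reals all_analysis.

Set Implicit Arguments.
Unset Strict Implicit.
Unset Printing Implicit Defensive.

Import Order.TTheory GRing.Theory Num.Theory.
Import numFieldNormedType.Exports.

Local Open Scope ring_scope.

(** * Sequences over the cyclic group

    The cyclic group of order [n] is ['Z_n].  For [n = 0, 1] this type is Z/2
    instead, but every statement below is a limit as [n] tends to infinity. *)

(** An unordered sequence is given by its multiplicities.  The bound [m] makes
    the type finite; it excludes no sequence of length at most [m], and no
    subsequence of such a sequence. *)
Definition mseq (n m : nat) := {ffun 'Z_n -> 'I_m.+1}.

Definition mlength (n m : nat) (S : mseq n m) : nat := (\sum_(a : 'Z_n) S a)%N.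

Definition msum (n m : nat) (S : mseq n m) : 'Z_n := \sum_(a : 'Z_n) a *+ S a.

Definition msupp (n m : nat) (S : mseq n m) : {set 'Z_n} :=
  [set a : 'Z_n | (0 < S a)%N].

Definition msubseq (n m : nat) (T S : mseq n m) : bool :=
  [forall a : 'Z_n, (T a <= S a)%N].

Definition zero_sum_free (n m : nat) (S : mseq n m) : bool :=
  [forall T : mseq n m,
     (msubseq T S && (0 < mlength T)%N) ==> (msum T != 0)].

(** Number of zero-sum free sequences of length [m] with exactly [d] distinct
    elements that are contained in [A]. *)
Definition num_zsf (n m d : nat) (A : {set 'Z_n}) : nat :=
  #|[set S : mseq n m | [&& mlength S == m, zero_sum_free S,
                            #|msupp S| == d & msupp S \subset A]]|.

Definition num_generators (n : nat) : nat :=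
  #|[set g : 'Z_n | generator [set: 'Z_n] g]|.

(** Number of partitions of [j] with exactly [d] different part sizes.  A
    partition of [j] has at most [j] parts, each at most [j], so bounded
    sequences over ['I_j.+1] represent all of them. *)
Definition q (j d : nat) : nat :=
  #|[set s : {bseq j of 'I_j.+1} |
       let t := [seq val i | i <- s] in
       [&& sorted leq t, all (leq 1) t, sumn t == j & size (undup t) == d]]|.

(** * Random subsets and asymptotics *)

(** Probability of the event [E] for the random subset of ['Z_n] containing
    each element independently with probability [p]. *)
Definition prob_subset (R : realType) (n : nat) (p : R)
    (E : pred {set 'Z_n}) : R :=
  \sum_(A : {set 'Z_n} | E A) p ^+ #|A| * (1 - p) ^+ #|~: A|.

Local Open Scope classical_set_scope.

Definition aas (R : realType) (p : nat -> R)
    (E : forall n : nat, pred {set 'Z_n}) : Prop :=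
  prob_subset (p n) (E n) @[n --> \oo] --> (1 : R).

(** Division by zero being total, [f / g --> 0] alone would not rule out that
    [g] vanishes infinitely often. *)
Definition negligible_wrt (R : realType) (f g : nat -> R) : Prop :=
  (\forall n \near \oo, g n != 0) /\ (f n / g n @[n --> \oo] --> (0 : R)).

(* Main.v *)
(** Write a sequence as [t] pairs of distinct elements together with [m] copies
    of one element [g].  If it is zero-sum free then, by Scherk's theorem on
    sumsets, every pair contributes at least 3 and every copy of [g] at least 1
    to the number of nonzero subset sums, so that [3 t + m < n].  When the length
    is [n - 1 - k] this gives [t <= k]: all but [O(k)] terms equal [g], [g] is a
    generator, and a greedy argument shows that the terms are multiples [x g]
    whose positive coefficients [x] have sum less than [n].  Subtracting 1 from
    the coefficients turns such a sequence into a partition of some [j <= k],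
    and [g] is recovered as its most frequent term.

    The sequences contained in the random subset are then counted by a second
    moment computation: a given sequence shares an element with only [O_k(1)]
    others, so the variance is [O_k(p^d phi(n))] and Chebyshev's inequality
    suffices; the constant [c] can be taken to be [1]. *)
Require Import Defs.
From mathcomp Require Import all_boot all_order all_algebra all_fingroup.
From mathcomp Require Import cyclic zify ring.
From mathcomp Require Import all_classical all_reals all_analysis.

Set Implicit Arguments.
Unset Strict Implicit.
Unset Printing Implicit Defensive.

Import Order.TTheory GRing.Theory Num.Theory.
Import numFieldNormedType.Exports.

Local Open Scope ring_scope.

(** * Zero-sum free sequences with few terms missing *)

Definition sumset (G : finZmodType) (A B : {set G}) : {set G} :=
  [set x + y | x in A, y in B].

(* Induction on [#|B|] through the Dyson e-transform. *)
Lemma scherk (G : finZmodType) (A B : {set G}) :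
  0 \in A -> 0 \in B ->
  (forall a b, a \in A -> b \in B -> a + b = 0 -> a = 0 /\ b = 0) ->
  (#|A| + #|B| <= (#|sumset A B|).+1)%N.
Proof.
have [m] := ubnP #|B|; elim: m A B => // m IHm A B ltBm A0 B0 AB0.
have [/existsP[e /andP[Ae /subsetPn[y]]]|] :=
    boolP [exists e in A, ~~ ([set e + b | b in B] \subset A)]; last first.
  rewrite negb_exists => /forallP stabA.
  suff /subset_leq_card : B \subset [set 0].
    have /subset_leq_card : A \subset sumset A B.
      by apply/fintype.subsetP => x Ax; apply/imset2P; exists x 0; rewrite ?addr0.
    rewrite cards1; lia.
  (* [A] is stable under adding [b], so it contains every multiple of [b], in particular [- b]; as 0
     has only the trivial representation, [b = 0]. *)
  apply/fintype.subsetP => b Bb; rewrite inE.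
  have iterA j : b *+ j \in A.
    elim: j => [|j IHj]; first by rewrite mulr0n.
    have := stabA (b *+ j); rewrite negb_and negbK IHj /= => /fintype.subsetP.
    by apply; apply/imsetP; exists b => //; rewrite mulrSr.
  have /AB0 : b *+ #[b]%g.-1 \in A by [].
  move=> /(_ b Bb) []; last by move=> _ ->.
  by rewrite -mulrSr prednK ?order_gt0 // -FinRing.zmodXgE expg_order.
move=> /imsetP[b Bb ->{y}] nAeb.
(* [A] gains [e + B], while [B] keeps only the [b] with [e + b] in [A]: the total cardinality is
   preserved, the sumset does not grow, and [B] strictly shrinks. *)
pose A' := A :|: [set e + b | b in B].
pose B' := [set b in B | e + b \in A].
have cardAB : (#|A'| + #|B'| = #|A| + #|B|)%N.
  have -> : #|B'| = #|A :&: [set e + b | b in B]|.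
    rewrite -(card_imset _ (addrI e)); apply: eq_card => x.
    rewrite !inE; apply/imsetP/andP => [[z]|[Ax /imsetP[z Bz xE]]].
      rewrite inE => /andP[Bz Az] ->; split => //.
      by apply/imsetP; exists z.
    by exists z => //; rewrite inE Bz -xE.
  by rewrite cardsUI card_imset //; apply: addrI.
have sA'B' : sumset A' B' \subset sumset A B.
  apply/fintype.subsetP => _ /imset2P[x z + + ->]; rewrite !inE.
  move=> /orP[Ax|/imsetP[c Bc ->]] /andP[Bz Az]; apply/imset2P.
    by exists x z.
  by exists (e + z) c => //; rewrite addrAC.
rewrite -cardAB; apply: leq_trans (_ : (#|sumset A' B'| < _)%N); last first.
  by rewrite ltnS subset_leq_card.
apply: IHm; rewrite ?inE ?A0 ?B0 ?addr0 //.
  rewrite ltnS in ltBm; apply: leq_trans ltBm.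
  apply/proper_card/properP; split; first by apply/fintype.subsetP => x; rewrite inE => /andP[].
  by exists b; rewrite // inE Bb.
move=> x z; rewrite !inE => /orP[Ax|/imsetP[c Bc ->]] /andP[Bz Az] xz0; first exact: AB0.
(* [(e + c) + z = 0] is regrouped as [(e + z) + c = 0], where [e + z] lies in [A] because [z] is in
   [B']. *)
have [|ez0 c0] := AB0 (e + z) c Az Bc; first by rewrite addrAC.
have [e0 z0] := AB0 e z Ae Bz ez0.
by rewrite e0 c0 z0 addr0.
Qed.

Definition sub_multiset (T : eqType) (t s : seq T) : Prop :=
  forall a, (count_mem a t <= count_mem a s)%N.

Definition zsfree (G : nmodType) (s : seq G) : Prop :=
  forall t, sub_multiset t s -> t != [::] -> \sum_(x <- t) x != 0.

Lemma sub_multiset_cat (T : eqType) (t1 t2 s1 s2 : seq T) :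
  sub_multiset t1 s1 -> sub_multiset t2 s2 -> sub_multiset (t1 ++ t2) (s1 ++ s2).
Proof. by move=> h1 h2 a; rewrite !count_cat leq_add. Qed.

Lemma sub_multiset_trans (T : eqType) (t s u : seq T) :
  sub_multiset t s -> sub_multiset s u -> sub_multiset t u.
Proof. by move=> h1 h2 a; apply: leq_trans (h2 a). Qed.

Lemma zsfree_sub (G : nmodType) (t s : seq G) :
  sub_multiset t s -> zsfree s -> zsfree t.
Proof. by move=> ts zs u ut; apply: zs; apply: sub_multiset_trans ts. Qed.

(** [A] may be any collection of subset sums of [s] containing 0, not necessarily all of them. *)
Definition subsums (G : finZmodType) (s : seq G) (A : {set G}) : Prop :=
  0 \in A /\ forall a, a \in A -> exists2 t, sub_multiset t s & \sum_(x <- t) x = a.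

(** A relation [a + b = 0] comes from a subsequence of [s1 ++ s2] with sum zero; zero-sum freeness
    makes it empty, which is the hypothesis of [scherk]. *)
Lemma subsums_cat (G : finZmodType) (s1 s2 : seq G) (A B : {set G}) :
  zsfree (s1 ++ s2) -> subsums s1 A -> subsums s2 B ->
  subsums (s1 ++ s2) (sumset A B) /\ (#|A| + #|B| <= (#|sumset A B|).+1)%N.
Proof.
move=> zs [A0 sA] [B0 sB]; split; first split.
- by apply/imset2P; exists 0 0; rewrite ?addr0.
- move=> _ /imset2P[a b /sA[t1 s1t1 <-] /sB[t2 s2t2 <-] ->].
  by exists (t1 ++ t2); rewrite ?big_cat //; apply: sub_multiset_cat.
- apply: scherk => // a b /sA[t1 s1t1 <-] /sB[t2 s2t2 <-].
  rewrite -big_cat => /eqP sum0.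
  have := zs _ (sub_multiset_cat s1t1 s2t2).
  have [|//] := eqVneq (t1 ++ t2) [::]; last by move=> _ /(_ isT); rewrite sum0.
  by case: t1 {s1t1 sum0} => //= -> _; rewrite big_nil.
Qed.

Definition unpair (T : Type) (P : seq (T * T)) : seq T :=
  flatten [seq [:: u.1; u.2] | u <- P].

Lemma size_unpair (T : Type) (P : seq (T * T)) : size (unpair P) = (size P).*2.
Proof. by elim: P => //= u P IH; rewrite IH. Qed.

(** By [subsums_cat], prepending a block with [c] different subset sums adds at least [c - 1]
    elements: a pair has four sums, a single [g] has two. The inequality is strict because 0 is
    counted too. *)
Lemma zsfree_card (G : finZmodType) (P : seq (G * G)) m g :
  all (fun u => u.1 != u.2) P -> zsfree (unpair P ++ nseq m g) ->
  (3 * size P + m < #|G|)%N.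
Proof.
move=> neqP zs.
suff [A [_ leA]] : exists A, subsums (unpair P ++ nseq m g) A /\
    (3 * size P + m < #|A|)%N by apply: leq_trans leA (max_card _).
elim: P neqP zs => [|[a b] P IHP] /=.
  move=> _; elim: m => [|m IHm] zs.
    exists [set 0]; rewrite cards1; split => //; split; first exact: set11.
    by move=> a /set1P ->; exists [::]; rewrite ?big_nil.
  have /IHm[A [sA leA]] : zsfree (nseq m g).
    by apply: zsfree_sub zs => a /=; apply: leq_addl.
  have sB : subsums [:: g] [set 0; g].
    split=> [|a /set2P[]->]; first by rewrite !inE eqxx.
      by exists [::]; rewrite ?big_nil.
    by exists [:: g]; rewrite ?big_seq1.
  have [] := subsums_cat (zs : zsfree ([:: g] ++ nseq m g)) sB sA.
  move=> sBA leBA; exists (sumset [set 0; g] A); split => //.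
  have cB : #|[set 0; g]| = 2.
    rewrite cards2; suff : g != 0 by rewrite eq_sym => ->.
    have := zs [:: g]; rewrite big_seq1; apply => //.
    by move=> a /=; rewrite addn0 leq_addr.
  rewrite cB in leBA; rewrite -ltnS; apply: leq_trans leBA.
  by rewrite addnS; apply: (leq_add (leqnn 2) leA).
move=> /andP[neq_ab neqP] zs.
have /(IHP neqP)[A [sA leA]] : zsfree (unpair P ++ nseq m g).
  by apply: zsfree_sub zs => x /=; rewrite addnA leq_addl.
pose B := [set 0; a; b; a + b].
have sB : subsums [:: a; b] B.
  split=> [|x]; first by rewrite !inE eqxx.
  rewrite !inE -!orbA => /or4P[]/eqP->.
  - by exists [::]; rewrite ?big_nil.
  - by exists [:: a]; rewrite ?big_seq1 // => y /=; rewrite addn0 leq_addr.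
  - by exists [:: b]; rewrite ?big_seq1 // => y /=; rewrite leq_addl.
  - by exists [:: a; b]; rewrite ?big_cons ?big_nil ?addr0.
have [sBA leBA] := subsums_cat (zs : zsfree ([:: a; b] ++ _)) sB sA.
exists (sumset B A); split => //.
suff cB : #|B| = 4.
  rewrite cB in leBA.
  rewrite -ltnS; apply: leq_trans leBA.
  apply: leq_trans (leq_add (leqnn 4) leA).
  by rewrite mulnS; lia.
have neq0 t : sub_multiset t [:: a; b] -> t != [::] -> \sum_(x <- t) x != 0.
  apply: (zsfree_sub _ zs) => x /=; lia.
have a0 : a != 0.
  by have := neq0 [:: a]; rewrite big_seq1; apply => // x /=; rewrite addn0 leq_addr.
have b0 : b != 0.
  by have := neq0 [:: b]; rewrite big_seq1; apply => // x /=; rewrite leq_addl.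
have ab0 : a + b != 0.
  by have := neq0 [:: a; b]; rewrite !big_cons big_nil addr0; apply => // x /=; rewrite leq_addl.
(* [a], [b] and [a + b] are nonzero by zero-sum freeness; [a != b] is the defining property of a
   pair. *)
have uniqB : uniq [:: 0; a; b; a + b].
  rewrite /= !inE !negb_or !(eq_sym 0) a0 b0 ab0 neq_ab /= andbT.
  by rewrite -{1}[a]addr0 -{2}[b]add0r (inj_eq (addrI a)) (inj_eq (addIr b)) !(eq_sym 0) b0 a0.
rewrite -[RHS]/(size [:: 0; a; b; a + b]) -(card_uniqP uniqB).
by apply: eq_card => x; rewrite !inE !orbA.
Qed.

(** Terms are inserted one by one. A term different from [g] is paired with a copy of [g]; when no
    copy is left, the new term becomes [g]. *)
Lemma pairing (T : eqType) (x0 : T) (s : seq T) :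
  exists P m g, all (fun u : T * T => u.1 != u.2) P /\
    perm_eq s (unpair P ++ nseq m g).
Proof.
elim: s => [|x s [P [m [g [neqP perm_s]]]]]; first by exists [::], 0%N, x0.
case: m perm_s => [|m] perm_s.
  exists P, 1%N, x; split => //=.
  by rewrite cats1 perm_sym perm_rcons perm_cons perm_sym -[unpair P]cats0.
have [->|neq_xg] := eqVneq x g.
  exists P, m.+2, g; split => //=.
  by rewrite perm_sym -(cat1s g (g :: _)) perm_catCA /= perm_cons perm_sym.
exists ((x, g) :: P), m, g; rewrite /= neq_xg neqP; split => //.
rewrite perm_cons; apply: perm_trans perm_s _.
by rewrite (perm_catCA (unpair P) [:: g] (nseq m g)).
Qed.

Lemma perm_sub_multiset (T : eqType) (t s : seq T) :
  perm_eq t s -> sub_multiset t s.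
Proof. by move=> /seq.permP ts a; rewrite ts. Qed.

(** * Generators of the cyclic group as units *)

Section ModularUnits.
Variable n : nat.
Hypothesis n_gt1 : (1 < n)%N.

Lemma natr_Zp_order (g : 'Z_n) : g *+ n = 0.
Proof.
by rewrite -mulr_natr; have -> : n%:R = 0 :> 'Z_n; [exact: pchar_Zp | rewrite mulr0].
Qed.

Lemma card_Zn : #|'Z_n| = n.
Proof. by rewrite card_ord Zp_cast. Qed.

Lemma ltn_Zn (x : 'Z_n) : (x < n)%N.
Proof. by rewrite -[X in (_ < X)%N]card_Zn card_ord. Qed.

Lemma generator_unit (g : 'Z_n) : generator [set: 'Z_n] g = (g \is a GRing.unit).
Proof.
apply/eqP/idP => [gen_g | Ug].
  have : 1 \in <[g]>%g by rewrite -gen_g inE.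
  move=> /cycleP[i]; rewrite FinRing.zmodXgE -mulr_natr => g1.
  by apply/unitrP; exists i%:R; rewrite mulrC -g1.
apply/setP => a; rewrite inE; apply/esym/cycleP; exists ((g^-1 * a)%R : 'Z_n).
by rewrite FinRing.zmodXgE -mulr_natr natr_Zp mulVKr.
Qed.

(** As many copies of [g] as its order sum to 0, so the order exceeds [m], hence [n / 2]; a divisor
    of [n] that large is [n]. *)
Lemma zsfree_nseq_generator m (g : 'Z_n) :
  (n <= 2 * m)%N -> zsfree (nseq m g) -> generator [set: 'Z_n] g.
Proof.
move=> le_n2m zs.
have lt_m : (m < #[g]%g)%N.
  rewrite ltnNge; apply/negP => le_gm.
  suff : \sum_(x <- nseq #[g]%g g) x != 0.
    by rewrite big_nseq iter_addr_0 -FinRing.zmodXgE expg_order eqxx.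
  apply: zs => [a|]; first by rewrite !count_nseq leq_mul.
  by move: (order_gt0 g); case: #[g]%g.
have : (#[g]%g %| n)%N by rewrite -[X in (_ %| X)%N]card_Zn -cardsT order_dvdG ?inE.
move=> /dvdnP[c nE].
have c1 : c = 1%N.
  case: c nE => [|[|c]] // nE; first by move: n_gt1; rewrite nE.
  have := leq_mul (isT : (2 <= c.+2)%N) lt_m; rewrite -nE; lia.
rewrite /generator eq_sym eqEcard finset.subsetT /= cardsT card_Zn.
by rewrite {1}nE c1 mul1n.
Qed.

End ModularUnits.

(** Discrete continuity: partial sums move in steps of at most [b], so they cannot jump over a
    window of length [b]. *)
Lemma prefix_sum (T : eqType) (f : T -> nat) (b v : nat) (s : seq T) :
  (forall x, x \in s -> f x <= b)%N -> (0 < v <= \sum_(x <- s) f x)%N ->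
  exists i, (v <= \sum_(x <- take i s) f x < v + b)%N.
Proof.
elim: s v => [|x s IH] v leb; first by rewrite big_nil; lia.
rewrite big_cons => /andP[v0 lev].
have lex : (f x <= b)%N by apply: leb; rewrite inE eqxx.
have [le_vx|lt_xv] := leqP v (f x).
  by exists 1%N; rewrite /= take0 big_seq1; lia.
have [||i hi] := IH (v - f x)%N; first by move=> y sy; apply: leb; rewrite inE sy orbT.
  by lia.
by exists i.+1; rewrite /= big_cons; lia.
Qed.

(* The coefficient of [a] as a multiple of [g]; junk unless [g] is invertible. *)
Definition dlog n (g a : 'Z_n) : nat := ((g^-1 * a)%R : 'Z_n).

Lemma dlogK n (g a : 'Z_n) : g \is a GRing.unit -> g *+ dlog g a = a.
Proof. by move=> Ug; rewrite -mulr_natr natr_Zp mulVKr. Qed.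

Lemma sum_dlog n (g : 'Z_n) (s : seq 'Z_n) : g \is a GRing.unit ->
  \sum_(a <- s) a = g *+ (\sum_(a <- s) dlog g a)%N.
Proof.
by move=> Ug; rewrite -sumrMnr; apply: eq_bigr => a _; rewrite dlogK.
Qed.

Lemma savchev_chen n k (s : seq 'Z_n) :
  (8 * k + 4 < n)%N -> (size s + k.+1)%N = n -> zsfree s ->
  exists2 g, generator [set: 'Z_n] g & (\sum_(a <- s) dlog g a < n)%N.
Proof.
move=> lt_kn size_s zs; have n1 : (1 < n)%N by lia.
have [P [m [g [neqP perm_s]]]] := @pairing 'Z_n 0 s.
have {}zs : zsfree (unpair P ++ nseq m g).
  by apply: zsfree_sub zs; apply: perm_sub_multiset; rewrite perm_sym.
pose p := size P.
have cardP : (3 * p + m < n)%N by rewrite -[X in (_ < X)%N](card_Zn n1); apply: zsfree_card zs.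
have sizeP : (p.*2 + m + k.+1 = n)%N.
  by rewrite -size_s (perm_size perm_s) size_cat size_unpair size_nseq.
(* Comparing [cardP] with [sizeP] gives [p <= k], hence [m >= n - 1 - 3 k], which is at least
   [n / 2]. *)
have gen_g : generator [set: 'Z_n] g.
  apply: (@zsfree_nseq_generator n n1 m); first by lia.
  by apply: zsfree_sub zs => a; rewrite count_cat leq_addl.
have Ug : g \is a GRing.unit by rewrite -generator_unit.
exists g => //; rewrite (perm_big _ perm_s) big_cat big_nseq /=.
have -> : dlog g g = 1%N.
  by rewrite /dlog mulVr // -[1]/(1%:R) val_Zp_nat // modn_small.
rewrite iter_addn_0 mul1n.
(* No coefficient sum [W] of paired terms lies between [n - m] and [n]: otherwise [n - W] copies of
   [g] would complete it to [g *+ n = 0]. *)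
have small u : sub_multiset u (unpair P) -> u != [::] ->
    (\sum_(a <- u) dlog g a <= n -> \sum_(a <- u) dlog g a + m < n)%N.
  move=> sub_u u0 le_un; rewrite ltnNge; apply/negP => le_nu.
  set W := (\sum_(a <- u) _)%N in le_un le_nu.
  suff : \sum_(a <- u ++ nseq (n - W) g) a != 0.
    rewrite big_cat /= (sum_dlog _ Ug) big_nseq iter_addr_0 -mulrnDr.
    by rewrite subnKC // natr_Zp_order ?eqxx.
  apply: zs; last by case: (u) u0.
  apply: sub_multiset_cat => // a; rewrite !count_nseq leq_mul //; lia.
rewrite ltnNge; apply/negP => le_nW.
(* A prefix with sum in [n - m, n], completed by copies of [g], has sum zero. *)
have [||i /andP[lei lti]] := @prefix_sum _ (dlog g) (3 * k) (n - m) (unpair P).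
(* A single coefficient is below [n], hence by [small] below [n - m <= 3 k + 1]. *)
- move=> a Pa; have := small [:: a]; rewrite big_seq1.
  have lt_an : (dlog g a < n)%N by apply: ltn_Zn.
  move=> /(_ _ isT (ltnW lt_an)) lt_am.
  suff /lt_am : sub_multiset [:: a] (unpair P).
    by move: (dlog g a) => x; lia.
  by move=> b /=; rewrite addn0; case: eqVneq => // <-; rewrite -has_count has_pred1.
- by rewrite leq_subLR addnC le_nW andbT; lia.
have sub_i : sub_multiset (take i (unpair P)) (unpair P).
  by move=> a; rewrite -{2}(cat_take_drop i (unpair P)) count_cat leq_addr.
have u0 : take i (unpair P) != [::].
  by apply: contraTneq lei => ->; rewrite big_nil; lia.
have leWn : (\sum_(x <- take i (unpair P)) dlog g x <= n)%N.
  by apply: leq_trans (ltnW lti) _; lia.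
by have := small _ sub_i u0 leWn; rewrite ltnNge addnC -leq_subLR lei.
Qed.

(** * Sequences given by multiplicities *)

Definition repeat_seq (T : finType) (f : T -> nat) : seq T :=
  flatten [seq nseq (f a) a | a <- enum T].

Lemma sum_repeat_seq (T : finType) (V : nmodType) (f : T -> nat) (F : T -> V) :
  \sum_(a <- repeat_seq f) F a = \sum_(a : T) F a *+ f a.
Proof.
rewrite /repeat_seq big_flatten big_map big_enum /=.
by apply: eq_bigr => a _; rewrite big_nseq iter_addr_0.
Qed.

Lemma count_repeat_seq (T : finType) (f : T -> nat) a : count_mem a (repeat_seq f) = f a.
Proof.
rewrite -sum1_count big_mkcond /=.
rewrite (@sum_repeat_seq T nat f (fun b => if b == a then 1%N else 0%N)).
rewrite (bigD1 a) //= eqxx big1 ?addr0 ?natr1E => [|b /negPf->].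
  by rewrite -[RHS]mul1n -[LHS]/(1%N *+ f a) -mulr_natr natn.
by rewrite mul0rn.
Qed.

Lemma perm_repeat_seq (T : finType) (t : seq T) :
  perm_eq t (repeat_seq (fun a => count_mem a t)).
Proof. by apply/allP => a _ /=; rewrite count_repeat_seq. Qed.

Section Sequences.
Variables n m : nat.
Implicit Types S T : mseq n m.

Definition mseq_seq S : seq 'Z_n := repeat_seq (fun a : 'Z_n => S a : nat).

Lemma size_mseq_seq S : size (mseq_seq S) = mlength S.
Proof.
rewrite -sum1_size (@sum_repeat_seq _ nat (fun a : 'Z_n => S a : nat) (fun=> 1%N)).
by apply: eq_bigr => a _; rewrite -[LHS]mulr_natr mul1r natn.
Qed.

Lemma zsfree_mseq_seq S : zero_sum_free S -> zsfree (mseq_seq S).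
Proof.
move=> /forallP zS t tS t0; pose T : mseq n m := [ffun a => inord (count_mem a t)].
(* The counts of [t] are bounded by those of [S], so [inord] does not truncate. *)
have TE a : T a = count_mem a t :> nat.
  by rewrite ffunE inordK // ltnS; apply: leq_trans (tS a) _; rewrite count_repeat_seq -ltnS.
have perm_t : perm_eq t (mseq_seq T).
  by apply/allP => a _ /=; rewrite count_repeat_seq TE.
rewrite (perm_big _ perm_t) /= (sum_repeat_seq _ (fun a : 'Z_n => a)).
apply: (implyP (zS T)); apply/andP; split.
  by apply/forallP => a; rewrite TE -(count_repeat_seq (fun a : 'Z_n => S a : nat)).
by rewrite -size_mseq_seq -(perm_size perm_t) lt0n size_eq0.
Qed.

(** The coefficients are added as natural numbers, without reduction modulo [n]. *)
Definition index_sum (g : 'Z_n) S : nat := (\sum_(a : 'Z_n) dlog g a * S a)%N.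

Lemma msum_index (g : 'Z_n) S : g \is a GRing.unit -> Defs.msum S = g *+ index_sum g S.
Proof.
move=> Ug; rewrite -sumrMnr; apply: eq_bigr => a _.
by rewrite mulrnA dlogK.
Qed.

Hypothesis n_gt1 : (1 < n)%N.

Lemma unit_mulrn_eq0 (g : 'Z_n) j : g \is a GRing.unit -> (g *+ j == 0) = (n %| j)%N.
Proof.
move=> Ug; rewrite -mulr_natr -(mulr0 g) (inj_eq (mulrI Ug)) -val_eqE /= val_Zp_nat //.
Qed.

Lemma dlog_gt0 (g a : 'Z_n) : g \is a GRing.unit -> (0 < dlog g a)%N = (a != 0).
Proof.
move=> Ug; rewrite -[in RHS](dlogK a Ug) unit_mulrn_eq0 //.
case: posnP => [->|dl0]; first by rewrite dvdn0.
by rewrite gtnNdvd // ltn_Zn.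
Qed.

(** Without the term 0 all coefficients are at least 1, so a nonempty subsequence has coefficient
    sum strictly between 0 and [n], which is not divisible by [n]. *)
Lemma index_sum_zero_sum_free (g : 'Z_n) S :
  generator [set: 'Z_n] g -> S 0 = 0%N :> nat -> (index_sum g S < n)%N ->
  zero_sum_free S.
Proof.
rewrite generator_unit // => Ug S0 ltSn; apply/forallP => T; apply/implyP.
move=> /andP[/forallP TS T0]; rewrite (msum_index T Ug) unit_mulrn_eq0 //.
rewrite gtnNdvd //; last first.
  by apply: leq_ltn_trans ltSn; apply: leq_sum => a _; rewrite leq_mul.
apply: leq_trans T0 _; apply: leq_sum => a _; case: (posnP (T a)) => [->//|Ta].
rewrite leq_pmull // dlog_gt0 //; apply: contraTneq Ta => ->.
by rewrite -leqNgt -S0.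
Qed.

End Sequences.

(** The converse for long sequences, from [savchev_chen]. The absence of 0 is recorded separately,
    since its coefficient 0 is invisible to [index_sum]. *)
Lemma zero_sum_free_index_sum n k (S : mseq n (n - 1 - k)) :
  (8 * k + 4 < n)%N -> mlength S = (n - 1 - k)%N -> zero_sum_free S ->
  exists2 g : 'Z_n, generator [set: 'Z_n] g &
    S 0 = 0%N :> nat /\ (index_sum g S < n)%N.
Proof.
move=> lt_kn lenS zS; have zs := zsfree_mseq_seq zS.
have [|g gen_g ltg] := @savchev_chen n k (mseq_seq S) lt_kn _ zs.
  by rewrite size_mseq_seq lenS; lia.
exists g => //; split.
  apply/eqP; rewrite -leqn0 leqNgt; apply/negP => S0.
  suff : \sum_(a <- [:: 0 : 'Z_n]) a != 0 by rewrite big_seq1 eqxx.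
  by apply: zs => // a /=; rewrite addn0 count_repeat_seq; case: eqVneq => // <-.
apply: leq_ltn_trans ltg; rewrite (@sum_repeat_seq _ nat) /index_sum.
by apply: leq_sum => a _; rewrite -[X in (_ <= X)%N]mulr_natr natn.
Qed.

Lemma sum_dlog_nat n (g : 'Z_n) (G : nat -> nat) : (1 < n)%N ->
  generator [set: 'Z_n] g ->
  (\sum_(a : 'Z_n) G (dlog g a) = \sum_(0 <= x < n) G x)%N.
Proof.
move=> n1; rewrite generator_unit // => Ug.
rewrite -[in RHS](Zp_cast n1) big_mkord (reindex_inj (mulrI Ug)) /=.
by apply: eq_bigr => x _; rewrite /dlog mulKr.
Qed.

(** Coefficients are split into 0, then 1 (the element [g]), then [i.+2] with [i < k] (the part
    [i.+1]). *)
Lemma sum_nat_trunc n k (G : nat -> nat) : (k.+2 <= n)%N ->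
  (forall x, k.+2 <= x < n -> G x = 0)%N ->
  (\sum_(0 <= x < n) G x = G 0 + G 1 + \sum_(i < k) G i.+2)%N.
Proof.
move=> le_kn G0; rewrite (big_cat_nat (n := k.+2)) //=.
rewrite [X in (_ + X)%N]big_nat_cond [X in (_ + X)%N]big1 ?addn0; last by move=> x; rewrite andbT => xk; apply: G0.
by rewrite big_mkord !big_ord_recl addnA.
Qed.

Lemma dlog_mulrn n (g : 'Z_n) x : (1 < n)%N -> generator [set: 'Z_n] g ->
  (x < n)%N -> dlog g (g *+ x) = x.
Proof.
move=> n1; rewrite generator_unit // => Ug lt_xn.
by rewrite /dlog -mulr_natr mulKr // val_Zp_nat // modn_small.
Qed.

Definition zsf_set n m d : {set mseq n m} :=
  [set S : mseq n m | [&& mlength S == m, zero_sum_free S & #|msupp S| == d]].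

Lemma card_msupp n m (S : mseq n m) : #|msupp S| = (\sum_(a : 'Z_n) (0 < S a))%N.
Proof.
rewrite -sum1dep_card big_mkcond /=.
by apply: eq_bigr => a _; case: ifP.
Qed.

(** * Sequences encoded by a generator and part multiplicities *)

Section PartMultiplicities.
Variable k : nat.
Implicit Types f : {ffun 'I_k -> 'I_k.+1}.

(* [f i] is the multiplicity of the part [i.+1], which encodes the term
   [g *+ i.+2] of a sequence. *)
Definition part_weight f : nat := (\sum_(i < k) i.+1 * f i)%N.

Definition part_mults (e : nat) : {set {ffun 'I_k -> 'I_k.+1}} :=
  [set f | (part_weight f <= k)%N && (#|[set i : 'I_k | (0 < f i)%N]| == e)].

Lemma leq_sum_part_weight f : (\sum_(i < k) f i <= part_weight f)%N.
Proof. by apply: leq_sum => i _; rewrite leq_pmull. Qed.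

(** Multiplicity of [g *+ x]: copies of [g] fill the length up to [m], and no coefficient exceeds
    [k.+1]. *)
Definition mult_of m f (x : nat) : nat :=
  match x with
  | 0 => 0
  | 1 => m - \sum_(i < k) f i
  | y.+2 => if insub y is Some i then f i else 0
  end.

Lemma mult_of_lift m f (i : 'I_k) : mult_of m f i.+2 = f i.
Proof. by rewrite /= valK. Qed.

Lemma mult_of_large m f x : (k.+2 <= x)%N -> mult_of m f x = 0%N.
Proof. by case: x => [|[|x]] // le_kx; rewrite /= insubF //; apply/negbTE; rewrite -leqNgt. Qed.

Definition mseq_of n m (g : 'Z_n) f : mseq n m :=
  [ffun a => inord (mult_of m f (dlog g a))].

Section Encoding.
Variable n : nat.
Hypothesis lt_kn : (8 * k + 4 < n)%N.
Let m := (n - 1 - k)%N.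
Implicit Types g a : 'Z_n.

Let n1 : (1 < n)%N. Proof. by move: lt_kn; lia. Qed.

Lemma leq_part_weight f (i : 'I_k) : (i.+1 * f i <= part_weight f)%N.
Proof. by rewrite /part_weight (bigD1 i) //= leq_addr. Qed.

Lemma mseq_ofE g f a : (part_weight f <= k)%N ->
  mseq_of m g f a = mult_of m f (dlog g a) :> nat.
Proof.
move=> le_fk; rewrite ffunE inordK // ltnS.
case: (dlog g a) => [|[|x]] //=; first exact: leq_subr.
case: insubP => // i _ _; apply: (@leq_trans k); last by move: lt_kn; rewrite /m; lia.
by apply: leq_trans le_fk; apply: leq_trans (leq_part_weight f i); rewrite leq_pmull.
Qed.

(** Length, support size and index are the cases where [G x y] is [y], [0 < y] and [x * y]. *)
Lemma sum_mseq_of (G : nat -> nat -> nat) g f :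
  (forall x, G x 0 = 0)%N -> (part_weight f <= k)%N -> generator [set: 'Z_n] g ->
  (\sum_(a : 'Z_n) G (dlog g a) (mseq_of m g f a) =
     G 1 (m - \sum_(i < k) f i) + \sum_(i < k) G i.+2 (f i))%N.
Proof.
move=> G0 le_fk gen_g; under eq_bigr => a _ do rewrite mseq_ofE //.
rewrite (@sum_dlog_nat n g (fun x => G x (mult_of m f x))) // (@sum_nat_trunc n k).
- by rewrite G0 add0n; congr (_ + _)%N; apply: eq_bigr => i _; rewrite mult_of_lift.
- by move: lt_kn; lia.
- by move=> x /andP[le_kx _]; rewrite mult_of_large.
Qed.

Lemma card_part_supp f : #|[set i : 'I_k | (0 < f i)%N]| = (\sum_(i < k) (0 < f i))%N.
Proof.
rewrite -sum1dep_card big_mkcond /=.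
by apply: eq_bigr => a _; case: ifP.
Qed.

Lemma mlength_mseq_of g f : (part_weight f <= k)%N -> generator [set: 'Z_n] g ->
  mlength (mseq_of m g f) = m.
Proof.
move=> le_fk gen_g; have := @sum_mseq_of (fun _ y => y) g f (fun=> erefl) le_fk gen_g.
rewrite /mlength => ->; rewrite subnK //.
apply: leq_trans (leq_sum_part_weight f) _; apply: leq_trans le_fk _.
by move: lt_kn; rewrite /m; lia.
Qed.

Lemma card_msupp_mseq_of g f : (part_weight f <= k)%N -> generator [set: 'Z_n] g ->
  #|msupp (mseq_of m g f)| = (#|[set i : 'I_k | (0 < f i)%N]|).+1.
Proof.
move=> le_fk gen_g; rewrite card_msupp card_part_supp.
rewrite (@sum_mseq_of (fun _ y => (0 < y) : nat) g f) // subn_gt0.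
suff -> : (\sum_(i < k) f i < m)%N by rewrite add1n.
apply: leq_ltn_trans (leq_sum_part_weight f) _; apply: leq_ltn_trans le_fk _.
by move: lt_kn; rewrite /m; lia.
Qed.

(** The index is the length plus the weight, at most [(n - 1 - k) + k < n]. *)
Lemma zero_sum_free_mseq_of g f : (part_weight f <= k)%N -> generator [set: 'Z_n] g ->
  zero_sum_free (mseq_of m g f).
Proof.
move=> le_fk gen_g; apply: (index_sum_zero_sum_free n1 gen_g).
  by rewrite mseq_ofE // /dlog mulr0.
rewrite /index_sum (@sum_mseq_of (fun x y => x * y)%N g f) // => [|x]; last by rewrite muln0.
have -> : (\sum_(i < k) i.+2 * f i = \sum_(i < k) f i + part_weight f)%N.
  by rewrite -big_split /=; apply: eq_bigr => i _; rewrite mulSn.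
rewrite mul1n addnA subnK; last first.
  apply: leq_trans (leq_sum_part_weight f) _; apply: leq_trans le_fk _.
  by move: lt_kn; rewrite /m; lia.
by move: lt_kn le_fk; rewrite /m; lia.
Qed.

Lemma mseq_of_zsf g f d : generator [set: 'Z_n] g -> f \in part_mults d ->
  mseq_of m g f \in zsf_set n m d.+1.
Proof.
move=> gen_g; rewrite !inE => /andP[le_fk /eqP card_f].
by rewrite mlength_mseq_of // zero_sum_free_mseq_of // card_msupp_mseq_of // card_f !eqxx.
Qed.

(** Index minus length is the sum of the coefficients diminished by 1. It is at most [k], so it
    bounds the weight of the multiplicities read off from [S] and excludes coefficients above
    [k.+1]. *)
Lemma zsf_mseq_of (S : mseq n m) d : S \in zsf_set n m d.+1 ->
  exists g f, [/\ generator [set: 'Z_n] g, f \in part_mults d & S = mseq_of m g f].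
Proof.
rewrite inE => /and3P[/eqP lenS zS /eqP suppS].
have [g gen_g [S0 ltS]] := zero_sum_free_index_sum lt_kn lenS zS.
have Ug : g \is a GRing.unit by rewrite -generator_unit.
pose s x := S (g *+ x) : nat.
have SE a : S a = s (dlog g a) :> nat by rewrite /s dlogK.
have le_pred : (\sum_(a : 'Z_n) (dlog g a).-1 * S a <= k)%N.
  suff : (\sum_(a : 'Z_n) (dlog g a).-1 * S a + mlength S = index_sum g S)%N.
    by move: lt_kn ltS; rewrite lenS /m; lia.
  rewrite -big_split /=; apply: eq_bigr => a _.
  have [->|a0] := eqVneq a 0; first by rewrite S0 !muln0.
  by rewrite addnC -mulSn prednK // dlog_gt0.
have le_s x : (x < n)%N -> (x.-1 * s x <= k)%N.
  move=> lt_xn; apply: leq_trans le_pred.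
  by rewrite (bigD1 (g *+ x)) //= dlog_mulrn // leq_addr.
have s_large x : (k.+2 <= x < n)%N -> s x = 0%N.
  move=> /andP[le_kx /le_s]; case: (s x) => // y.
  by move: le_kx; case: x => // x; rewrite mulnS /=; lia.
pose f : {ffun 'I_k -> 'I_k.+1} := [ffun i : 'I_k => inord (s i.+2)].
have fE i : f i = s i.+2 :> nat.
  rewrite ffunE inordK // ltnS; apply: leq_trans (le_s i.+2 _).
    by rewrite leq_pmull.
  by move: lt_kn (ltn_ord i); lia.
have le_kn : (k.+2 <= n)%N by move: lt_kn; lia.
have le_fk : (part_weight f <= k)%N.
  apply: leq_trans le_pred; apply/eq_leq.
  under [RHS]eq_bigr => a _ do rewrite SE.
  rewrite (@sum_dlog_nat n g (fun x => x.-1 * s x)%N) // (@sum_nat_trunc n k) //.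
    by rewrite !mul0n !add0n; apply: eq_bigr => i _; rewrite fE.
  by move=> x /s_large ->; rewrite muln0.
have s0 : s 0 = 0%N by rewrite /s mulr0n.
have sumS : (s 1 + \sum_(i < k) f i = m)%N.
  rewrite -[RHS]lenS /mlength; under [RHS]eq_bigr => a _ do rewrite SE.
  rewrite (@sum_dlog_nat n g s) // (@sum_nat_trunc n k) // s0 add0n.
  by congr (_ + _)%N; apply: eq_bigr => i _; rewrite fE.
have Sf : S = mseq_of m g f.
  apply/ffunP => a; apply/val_inj; rewrite /= mseq_ofE // SE.
  have := ltn_Zn n1 (g^-1 * a); rewrite -/(dlog g a).
  case: (dlog g a) => [|[|x]] lt_xn //=; first by rewrite -sumS addnK.
  case: insubP => [i _ <-|]; first by rewrite fE.
  by rewrite -leqNgt => le_kx; rewrite s_large //; lia.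
exists g, f; split => //; rewrite inE le_fk /=.
by move: suppS; rewrite Sf card_msupp_mseq_of // => -[->].
Qed.

Lemma mseq_of_inj g g' f f' : generator [set: 'Z_n] g -> generator [set: 'Z_n] g' ->
  (part_weight f <= k)%N -> (part_weight f' <= k)%N ->
  mseq_of m g f = mseq_of m g' f' -> (g, f) = (g', f').
Proof.
move=> gen_g gen_g' le_f le_f' eqS.
have dlog1 h : generator [set: 'Z_n] h -> dlog h h = 1%N.
  by move=> gen_h; rewrite -{2}[h]mulr1n dlog_mulrn.
(* [g] occurs at least [m - k > m / 2] times *)
have big_g h u : generator [set: 'Z_n] h -> (part_weight u <= k)%N ->
    (m - k <= mseq_of m h u h)%N.
  move=> gen_h le_u; rewrite mseq_ofE // dlog1 //= leq_sub2l //.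
  exact: leq_trans (leq_sum_part_weight u) le_u.
have eq_g : g = g'.
  apply/eqP/negPn/negP => neq_g.
  have := mlength_mseq_of le_f gen_g; rewrite /mlength (bigD1 g) //=.
  rewrite (bigD1 g') //=; last by rewrite eq_sym.
  have := big_g _ _ gen_g le_f; have := big_g _ _ gen_g' le_f'; rewrite -eqS.
  by move: lt_kn; rewrite /m; lia.
rewrite -eq_g in eqS *; congr (_, _); apply/ffunP => i; apply/val_inj => /=.
rewrite -!(mult_of_lift m) -(@dlog_mulrn n g i.+2) //; last by move: lt_kn (ltn_ord i); lia.
by rewrite -!mseq_ofE // eqS.
Qed.

Lemma card_zsf_set d :
  #|zsf_set n m d.+1| = (num_generators n * #|part_mults d|)%N.
Proof.
pose enc u := mseq_of m u.1 u.2 : mseq n m.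
pose D := finset.setX [set g : 'Z_n | generator [set: 'Z_n] g] (part_mults d).
have -> : zsf_set n m d.+1 = enc @: D.
  apply/setP => S; apply/idP/imsetP => [/zsf_mseq_of[g [f [gen_g Ff ->]]]|[[g f]]].
    by exists (g, f) => //; rewrite !inE gen_g; move: Ff; rewrite inE.
  by rewrite inE /= => /andP[gen_g Ff ->]; apply: mseq_of_zsf => //; rewrite inE in gen_g.
rewrite card_in_imset ?cardsX // => -[g f] [g' f'].
rewrite !inE /= => /and3P[gen_g le_f _] /and3P[gen_g' le_f' _].
exact: mseq_of_inj.
Qed.

(** Let [a] be [x] times [g] with [0 < x < k.+2]. As integers [x * g = v * n + a] with [v < k.+2],
    so [x] and [v] determine [g] by an exact division. Hence the bound counts triples [(x, v, f)]
    and does not depend on [n]. *)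
Lemma card_zsf_mem d a :
  (#|[set S in zsf_set n m d.+1 | a \in msupp S]|
     <= #|{: 'I_k.+2 * 'I_k.+2 * {ffun 'I_k -> 'I_k.+1}}|)%N.
Proof.
pose dec (u : 'I_k.+2 * 'I_k.+2 * {ffun 'I_k -> 'I_k.+1}) :=
  mseq_of m ((u.1.2 * n + a) %/ u.1.1)%:R u.2 : mseq n m.
rewrite -cardsT; apply: leq_trans (leq_imset_card dec _).
apply/subset_leq_card/fintype.subsetP => S; rewrite inE => /andP[/zsf_mseq_of].
move=> [g [f [gen_g Ff ->]]]; rewrite inE; move: Ff; rewrite inE => /andP[le_f _].
rewrite mseq_ofE // => supp_a.
have Ug : g \is a GRing.unit by rewrite -generator_unit.
have lt_x : (dlog g a < k.+2)%N.
  by rewrite ltnNge; apply: contraTN supp_a => le_x; rewrite mult_of_large.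
have x_gt0 : (0 < dlog g a)%N by case: (dlog g a) supp_a.
have lt_gn : (g < n)%N by apply: ltn_Zn.
have lt_v : ((dlog g a * g) %/ n < k.+2)%N.
  rewrite ltn_divLR; last by lia.
  by apply: leq_trans (_ : (k.+2 * g < _)%N); rewrite ?ltnS ?leq_mul // ?ltn_pmul2l // ltnW.
apply/imsetP; exists (Ordinal lt_x, Ordinal lt_v, f); rewrite ?inE //.
rewrite /dec /=; congr mseq_of.
have modE : a = ((dlog g a * g) %% n)%N :> nat.
  by rewrite -{1}(dlogK a Ug) -{1}(natr_Zp g) -mulrnA val_Zp_nat // mulnC.
by rewrite [X in (_ + X)%N]modE -divn_eq mulKn // natr_Zp.
Qed.

Lemma card_zsf_meet d (S : mseq n m) : S \in zsf_set n m d.+1 ->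
  (#|[set T in zsf_set n m d.+1 | ~~ [disjoint msupp S & msupp T]]|
     <= d.+1 * #|{: 'I_k.+2 * 'I_k.+2 * {ffun 'I_k -> 'I_k.+1}}|)%N.
Proof.
rewrite inE => /and3P[_ _ /eqP suppS].
set Z := zsf_set _ _ _.
apply: (@leq_trans #|\bigcup_(a in msupp S) [set T in Z | a \in msupp T]|).
  apply/subset_leq_card/fintype.subsetP => T; rewrite inE => /andP[ZT].
  move=> /pred0Pn[a /andP[Sa Ta]]; apply/finset.bigcupP; exists a => //.
  by rewrite inE ZT.
apply: (@leq_trans (\sum_(a in msupp S) #|[set T in Z | a \in msupp T]|)%N).
  elim/big_ind2: _ => [|A x B y leA leB|//]; first by rewrite cards0.
  by apply: leq_trans (leq_card_setU _ _) (leq_add leA leB).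
rewrite -suppS -sum_nat_const; apply: leq_sum => a _.
exact: card_zsf_mem.
Qed.
End Encoding.
End PartMultiplicities.

(** * Partitions *)

Section Partitions.
Variable k : nat.

Let part (i : 'I_k) : nat := i.+1.

Let part_inj : injective part.
Proof. by move=> i j [] /val_inj. Qed.

Lemma parts_lift (t : seq nat) : all (fun x => 0 < x <= k)%N t ->
  exists u : seq 'I_k, t = [seq part i | i <- u].
Proof.
elim: t => [|x t IHt] /=; first by exists [::].
move=> /andP[/andP[x0 xk] /IHt[u ->]].
have lt_xk : (x.-1 < k)%N by rewrite prednK.
by exists (Ordinal lt_xk :: u); rewrite /= /part /= prednK.
Qed.

Lemma count_parts (u : seq 'I_k) (i : 'I_k) : count_mem i.+1 [seq part i | i <- u] = count_mem i u.
Proof. by rewrite count_map; apply: eq_count => j /=; rewrite -[i.+1]/(part i) inj_eq. Qed.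

Lemma sumn_parts (u : seq 'I_k) :
  sumn [seq part i | i <- u] = (\sum_(i < k) i.+1 * count_mem i u)%N.
Proof.
rewrite sumnE big_map (perm_big _ (perm_repeat_seq u)) /= (@sum_repeat_seq _ nat).
by apply: eq_bigr => i _; rewrite -[LHS]mulr_natr natn.
Qed.

Lemma size_undup_parts (u : seq 'I_k) :
  size (undup [seq part i | i <- u]) = #|[set i : 'I_k | (0 < count_mem i u)%N]|.
Proof.
rewrite undup_map_inj // size_map -(card_uniqP (undup_uniq u)).
by apply: eq_card => i; rewrite inE mem_undup -has_count has_pred1.
Qed.

(** A sorted list is determined by its multiplicities. Conversely, multiplicities are expanded and
    sorted; the parts being positive with sum [j], their number and sizes are at most [j], so the
    list fits the bounded type. *)
Lemma card_partitions j e : (j <= k)%N ->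
  q j e = #|[set f : {ffun 'I_k -> 'I_k.+1} |
     (part_weight f == j) && (#|[set i : 'I_k | (0 < f i)%N]| == e)]|.
Proof.
move=> le_jk; rewrite /q; set Q := [set s | _]; set F := [set f | _].
pose tl (s : {bseq j of 'I_j.+1}) := [seq val i | i <- s].
pose enc (s : {bseq j of 'I_j.+1}) : {ffun 'I_k -> 'I_k.+1} :=
  [ffun i : 'I_k => inord (count_mem i.+1 (tl s))].
have encE s i : enc s i = count_mem i.+1 (tl s) :> nat.
  rewrite ffunE inordK // ltnS; apply: leq_trans (count_size _ _) _.
  by rewrite size_map; apply: leq_trans (size_bseq s) le_jk.
have liftQ s : s \in Q -> exists u : seq 'I_k, tl s = [seq part i | i <- u].
  rewrite inE => /and4P[_ /allP pos _ _]; apply: parts_lift.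
  apply/allP => x sx; rewrite (pos _ sx) /=.
  move: sx => /mapP[i _ ->]; by apply: leq_trans le_jk; rewrite -ltnS ltn_ord.
have enc_inj : {in Q &, injective enc}.
  move=> s s' Qs Qs' eqf; apply/val_inj/(inj_map val_inj).
  have [[u us] [u' us']] := (liftQ s Qs, liftQ s' Qs').
  move: Qs Qs'; rewrite !inE => /andP[sort_s _] /andP[sort_s' _].
  apply: (sorted_eq leq_trans anti_leq) sort_s sort_s' _.
  rewrite -![map _ _]/(tl _) us us' perm_map //; apply/allP => i _ /=.
  by rewrite -!count_parts -us -us' -!encE eqf.
rewrite -(card_in_imset enc_inj); apply: eq_card => f.
apply/imsetP/idP => [[s Qs ->]|].
  have [u us] := liftQ s Qs; move: Qs; rewrite !inE -/(tl s) us => /and4P[_ _ /eqP sumu /eqP sizeu].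
  rewrite -sumu sumn_parts -sizeu size_undup_parts /part_weight.
  apply/andP; split; apply/eqP.
    by apply: eq_bigr => i _; rewrite encE us count_parts.
  by apply: eq_card => i; rewrite !inE encE us count_parts.
rewrite inE => /andP[/eqP wf /eqP ef].
pose u := repeat_seq (fun i : 'I_k => f i : nat).
have cu i : count_mem i u = f i by rewrite count_repeat_seq.
pose t := sort leq [seq part i | i <- u].
have perm_t : perm_eq t [seq part i | i <- u] by rewrite perm_sort.
have sumt : sumn t = j.
  by rewrite (perm_sumn perm_t) sumn_parts -wf; apply: eq_bigr => i _; rewrite cu.
have pos_t x : x \in t -> (0 < x)%N by rewrite (perm_mem perm_t) => /mapP[i _ ->].
have size_t : (size t <= j)%N.
  rewrite -sumt; elim: (t) pos_t => //= x t' IH pos; rewrite -add1n leq_add //.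
    by apply: pos; rewrite inE eqxx.
  by apply: IH => y ty; apply: pos; rewrite inE ty orbT.
have le_t x : x \in t -> (x <= j)%N.
  by move=> /perm_to_rem /perm_sumn /=; rewrite sumt => ->; rewrite leq_addr.
have size_s : (size [seq (inord x : 'I_j.+1) | x <- t] <= j)%N by rewrite size_map.
pose s : {bseq j of 'I_j.+1} := Bseq size_s.
have tlE : tl s = t.
  rewrite /tl /= -map_comp map_id_in // => x /le_t le_x /=.
  by rewrite inordK.
exists s.
  rewrite inE -/(tl s) tlE sort_sorted; last exact: leq_total.
  rewrite sumt eqxx /= -ef; apply/andP; split; first exact/allP.
  rewrite (perm_size (perm_undup (perm_mem perm_t))) size_undup_parts.
  by apply/eqP/eq_card => i; rewrite !inE cu.
apply/ffunP => i; apply/val_inj; rewrite /= encE tlE.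
by rewrite (seq.permP perm_t) count_parts cu.
Qed.

(** [c] different positive integers add up to at least [1 + ... + c]. In the induction a new summand
    [m.+1] suffices because at most [m] were selected before. *)
Lemma triangular_sum (P : pred nat) m :
  ((\sum_(0 <= i < m | P i) 1) * (\sum_(0 <= i < m | P i) 1).+1
    <= 2 * \sum_(0 <= i < m | P i) i.+1)%N.
Proof.
have le_m c : (\sum_(0 <= i < c | P i) 1 <= c)%N.
  rewrite big_mkcond -[X in (_ <= X)%N](subn0 c) -[X in (_ <= X)%N]mul1n mulnC.
  by rewrite -sum_nat_const_nat; apply: leq_sum => i _; case: ifP.
elim: m => [|m IHm]; first by rewrite !big_geq.
rewrite [in X in (X * _)%N]big_mkcond [in X in (_ * X)%N]big_mkcond /= (big_mkcond P (fun i => i.+1)) /=.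
rewrite !big_nat_recr //= -!big_mkcond /=.
have := le_m m; case: (P m) IHm => /=; last by rewrite !addn0.
by move: (\sum_(0 <= i < m | P i) 1)%N (\sum_(0 <= i < m | P i) i.+1)%N => x y; nia.
Qed.

Lemma triangular_part_weight (f : {ffun 'I_k -> 'I_k.+1}) e :
  #|[set i : 'I_k | (0 < f i)%N]| = e -> ((e * e.+1) %/ 2 <= part_weight f)%N.
Proof.
move=> <-; set A := [set i | _].
have cardE : #|A| = (\sum_(0 <= x < k | [exists i in A, val i == x]) 1)%N.
  rewrite -sum1_card [RHS]big_mkord; apply: eq_bigl => i.
  apply/idP/existsP => [Ai|[j /andP[Aj /eqP/val_inj <-//]]].
  by exists i; rewrite Ai eqxx.
have weightE : (\sum_(0 <= x < k | [exists i in A, val i == x]) x.+1 <= part_weight f)%N.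
  rewrite big_mkord big_mkcond; apply: leq_sum => i _; case: ifP => // /existsP[j].
  by rewrite inE => /andP[fj /eqP/val_inj <-]; rewrite leq_pmulr.
apply: leq_trans weightE; apply: leq_trans (leq_div2r 2 _) _.
  by rewrite cardE; apply: triangular_sum.
by rewrite mulKn.
Qed.

(** Multiplicity functions are classified by weight [j]; below the triangular number the class is
    empty, so the lower summation limit loses nothing. *)
Lemma card_part_mults e :
  (\sum_((e * e.+1) %/ 2 <= j < k.+1) q j e = #|part_mults k e|)%N.
Proof.
rewrite -sum1_card (partition_big (fun f => inord (part_weight f) : 'I_k.+1) xpredT) //=.
rewrite (big_nat_widenl _ 0) //= big_mkcond big_mkord /=; apply: eq_bigr => j _.
rewrite (card_partitions e (ltn_ord j)); set F := [set f | _].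
have -> : (\sum_(f in part_mults k e | inord (part_weight f) == j) 1 = #|F|)%N.
  rewrite -sum1_card; apply: eq_bigl => f; rewrite !inE.
  apply/andP/andP => [[/andP[le_fk ->]]|[/eqP fj ->]].
    by rewrite -val_eqE /= inordK.
  by rewrite fj inord_val eqxx -ltnS ltn_ord.
case: leqP => // lt_je; apply/esym/eqP; rewrite cards_eq0; apply/eqP/setP => f.
rewrite !inE; apply/andP => -[/eqP fj /eqP /triangular_part_weight].
by rewrite fj leqNgt lt_je.
Qed.

End Partitions.

(** * Second moment of the number of members contained in a random subset *)

Section RandomSubset.
Variables (R : realType) (n : nat) (p : R).
Hypothesis p01 : 0 <= p <= 1.
Implicit Types A B : {set 'Z_n}.

Let p_ge0 : 0 <= p. Proof. by case/andP: p01. Qed.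
Let p_le1 : p <= 1. Proof. by case/andP: p01. Qed.

Let weight A : R := p ^+ #|A| * (1 - p) ^+ #|~: A|.

Let weight_ge0 A : 0 <= weight A.
Proof. by rewrite mulr_ge0 ?exprn_ge0 ?subr_ge0. Qed.

(** Expanding the product of [p + 0] over [B] and [p + (1 - p)] off [B] gives a sum over subsets
    [A], whose terms vanish unless [A] contains [B]. *)
Lemma prob_superset B : prob_subset p (fun A => B \subset A) = p ^+ #|B|.
Proof.
have -> : p ^+ #|B| = \prod_(a : 'Z_n) (p + if a \in B then 0 else 1 - p).
  rewrite (eq_bigr (fun a => if a \in B then p else 1)) => [|a _].
    by rewrite -big_mkcond prodr_const.
  by case: ifP => _; [rewrite addr0 | rewrite addrC subrK].
rewrite bigA_distr /prob_subset big_mkcond; apply: eq_bigr => A _.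
case: ifP => [BA|/negbT/subsetPn[b Bb nAb]]; last first.
  by rewrite (bigD1 b) //= (negPf nAb) Bb mul0r.
rewrite (eq_bigr (fun a => (if a \in A then p else 1) * (if a \in ~: A then 1 - p else 1))).
  by rewrite big_split -!big_mkcond !prodr_const.
move=> a _; rewrite inE; case: (boolP (a \in A)) => [|nAa]; first by rewrite mulr1.
rewrite mul1r; case: ifP => // Ba.
by rewrite (fintype.subsetP BA _ Ba) in nAa.
Qed.

Lemma prob_subsetT : prob_subset p (fun _ : {set 'Z_n} => true) = 1.
Proof.
rewrite -(expr0 p) -(@cards0 'Z_n) -prob_superset; apply: eq_bigl => A.
by rewrite finset.sub0set.
Qed.

Lemma markov_subset (Y : {set 'Z_n} -> R) (c : R) : (forall A, 0 <= Y A) -> 0 < c ->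
  c * (1 - prob_subset p (fun A => Y A <= c)) <= \sum_A weight A * Y A.
Proof.
move=> Y0 c0; rewrite -prob_subsetT /prob_subset -/weight.
rewrite [X in _ * (X - _)](bigID (fun A => Y A <= c)) /= addrAC subrr add0r mulr_sumr.
rewrite [leRHS](bigID (fun A => Y A <= c)) /= -[leLHS]add0r lerD //.
  by apply: sumr_ge0 => A _; rewrite mulr_ge0.
apply: ler_sum => A; rewrite -ltNge => /ltW le_cY.
by rewrite mulrC; exact: (ler_wpM2l (weight_ge0 A) le_cY).
Qed.

Section Family.
Variables (I : finType) (Z : {set I}) (B : I -> {set 'Z_n}) (d C : nat).
Hypothesis cardB : forall i, i \in Z -> #|B i| = d.
Hypothesis meetB : forall i, i \in Z ->
  (#|[set j in Z | ~~ [disjoint B i & B j]]| <= C)%N.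

Let X A : R := #|[set i in Z | B i \subset A]|%:R.
Let mu : R := p ^+ d * #|Z|%:R.

Let X_sum A : X A = \sum_(i in Z) (B i \subset A)%:R.
Proof.
rewrite /X -sum1_card natr_sum big_mkcond /= [RHS]big_mkcond.
by apply: eq_bigr => i _; rewrite inE; case: (i \in Z) => //=; case: (B i \subset A).
Qed.

Let expectation_superset (D : {set 'Z_n}) : \sum_A weight A * (D \subset A)%:R = p ^+ #|D|.
Proof.
rewrite -prob_superset /prob_subset [RHS]big_mkcond; apply: eq_bigr => A _.
by case: (D \subset A); rewrite (mulr1, mulr0).
Qed.

Lemma expectation_family : \sum_A weight A * X A = mu.
Proof.
under eq_bigr => A _ do rewrite X_sum mulr_sumr.
rewrite exchange_big /=; under eq_bigr => i Zi do rewrite expectation_superset cardB //.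
by rewrite sumr_const /mu mulr_natr.
Qed.

Lemma second_moment_family :
  \sum_A weight A * X A ^+ 2 = \sum_(i in Z) \sum_(j in Z) p ^+ #|B i :|: B j|.
Proof.
under eq_bigr => A _ do rewrite expr2 X_sum mulr_suml mulr_sumr.
rewrite exchange_big; apply: eq_bigr => i _ /=.
under eq_bigr => A _ do rewrite !mulr_sumr.
rewrite exchange_big; apply: eq_bigr => j _ /=.
rewrite -expectation_superset; apply: eq_bigr => A _.
by rewrite finset.subUset -natrM mulnb.
Qed.

(** Disjoint pairs have covariance 0. A meeting pair contributes at most [p ^+ d], its union
    containing [B i], and each [i] has at most [C] such partners. *)
Lemma variance_family : \sum_A weight A * (X A - mu) ^+ 2 <= C%:R * mu.
Proof.
have -> : \sum_A weight A * (X A - mu) ^+ 2 =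
    \sum_A weight A * X A ^+ 2 - \sum_(i in Z) \sum_(j in Z) p ^+ (d + d).
  transitivity (\sum_A (weight A * X A ^+ 2 - mu *+ 2 * (weight A * X A) + mu ^+ 2 * weight A)).
    by apply: eq_bigr => A _; ring.
  rewrite big_split sumrB -!mulr_sumr expectation_family.
  have -> : \sum_A weight A = 1 by rewrite -prob_subsetT.
  have -> : \sum_(i in Z) \sum_(j in Z) p ^+ (d + d) = mu ^+ 2.
    by rewrite !sumr_const exprD /mu mulr_natr expr2 mulrnAl mulrnAr.
  by rewrite /=; ring.
rewrite second_moment_family -sumrB.
have -> : C%:R * mu = \sum_(i in Z) C%:R * p ^+ d.
  by rewrite sumr_const -[RHS]mulr_natr -mulrA.
apply: ler_sum => i Zi; rewrite -sumrB.
apply: (@le_trans _ _ (\sum_(j in Z | ~~ [disjoint B i & B j]) p ^+ d)).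
  rewrite [leRHS]big_mkcondr /=; apply: ler_sum => j Zj; case: ifPn => [_|/negPn disj].
    rewrite lerBlDr ler_wpDr ?exprn_ge0 // ler_wiXn2l //.
    by rewrite -(cardB Zi) subset_leq_card // finset.subsetUl.
  by rewrite cardsU (eqP (_ : B i :&: B j == finset.set0)) ?setI_eq0 // cards0 subn0 !cardB // subrr.
rewrite (eq_bigl (mem [set j in Z | ~~ [disjoint B i & B j]])) => [|j]; last by rewrite !inE.
by rewrite sumr_const -[leLHS]mulr_natl ler_wpM2r ?exprn_ge0 // ler_nat meetB.
Qed.

(** Chebyshev's inequality: [markov_subset] applied to the squared deviation. *)
Lemma concentration_family (c : R) : 0 < c ->
  1 - C%:R * mu / c ^+ 2 <= prob_subset p (fun A => `|X A - mu| <= c).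
Proof.
move=> c0; rewrite lerBlDr -lerBlDl ler_pdivlMr ?exprn_gt0 // mulrC.
apply: le_trans variance_family.
have := @markov_subset (fun A => (X A - mu) ^+ 2) (c ^+ 2) (fun _ => sqr_ge0 _) (exprn_gt0 2 c0).
suff -> : prob_subset p (fun A => (X A - mu) ^+ 2 <= c ^+ 2) =
   prob_subset p (fun A => `|X A - mu| <= c) by [].
apply: eq_bigl => A; rewrite -[(X A - mu) ^+ 2]real_normK ?num_real //.
by rewrite ler_pXn2r // nnegrE // ltW.
Qed.
End Family.
End RandomSubset.

(** * Sequences with a single distinct element *)

Section SingleElement.
Variables n m : nat.
Hypotheses (n_gt1 : (1 < n)%N) (lt_mn : (m < n)%N) (le_n2m : (n <= 2 * m)%N).

Let m_gt0 : (0 < m)%N. Proof. by move: n_gt1 le_n2m; lia. Qed.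

Definition constant_mseq (g : 'Z_n) : mseq n m := [ffun a => if a == g then ord_max else ord0].

Lemma constant_mseqE g a : constant_mseq g a = (if a == g then m else 0%N) :> nat.
Proof. by rewrite ffunE; case: eqP. Qed.

Lemma msupp_constant g : msupp (constant_mseq g) = [set g].
Proof. by apply/setP => a; rewrite !inE constant_mseqE; case: eqP. Qed.

Lemma zsf_constant g : generator [set: 'Z_n] g -> constant_mseq g \in zsf_set n m 1.
Proof.
move=> gen_g; have Ug : g \is a GRing.unit by rewrite -generator_unit.
have sum_g (F : 'Z_n -> nat) : (\sum_a F a * constant_mseq g a = F g * m)%N.
  rewrite (bigD1 g) //= constant_mseqE eqxx big1 ?addn0 // => a /negPf neq_ag.
  by rewrite constant_mseqE neq_ag muln0.
rewrite inE msupp_constant cards1 eqxx andbT; apply/andP; split.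
  have := sum_g (fun=> 1%N); rewrite mul1n => {2}<-; apply/eqP.
  by apply: eq_bigr => a _; rewrite mul1n.
apply: (index_sum_zero_sum_free n_gt1 gen_g).
  rewrite constant_mseqE; case: eqP => // g0; move: Ug; by rewrite -g0 unitr0.
by rewrite /index_sum sum_g -{2}[g]mulr1n dlog_mulrn ?mul1n.
Qed.

Lemma constant_zsf (S : mseq n m) : S \in zsf_set n m 1 ->
  exists2 g, generator [set: 'Z_n] g & S = constant_mseq g.
Proof.
rewrite inE => /and3P[/eqP lenS zS /cards1P[g suppS]].
have S0 a : a != g -> S a = 0%N :> nat.
  move=> neq_ag; apply/eqP; rewrite -leqn0 leqNgt; apply: contra neq_ag => Sa.
  by have : a \in msupp S; [rewrite inE | rewrite suppS inE].
have Sg : S g = m :> nat.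
  by rewrite -[RHS]lenS /mlength (bigD1 g) //= big1 ?addn0.
exists g; last first.
  apply/ffunP => a; apply/val_inj; rewrite /= constant_mseqE.
  by case: eqVneq => [->|/S0].
apply: (zsfree_nseq_generator n_gt1 le_n2m).
apply: zsfree_sub (zsfree_mseq_seq zS) => a.
rewrite count_repeat_seq count_nseq /=; case: eqVneq => [<-|_]; last by rewrite mul0n.
by rewrite mul1n Sg.
Qed.

(** Kept apart from [card_zsf_set], whose condition [8 * k + 4 < n] fails for [k] near [n / 3]; here
    [n <= 2 * m] forces the repeated element to be a generator. *)
Lemma card_zsf_set1 : #|zsf_set n m 1| = num_generators n.
Proof.
have -> : zsf_set n m 1 = constant_mseq @: [set g : 'Z_n | generator [set: 'Z_n] g].
  apply/setP => S; apply/idP/imsetP => [/constant_zsf[g gen_g ->]|[g]].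
    by exists g; rewrite ?inE.
  by rewrite inE => gen_g ->; apply: zsf_constant.
rewrite card_imset // => g h eq_gh; apply/set1P.
by rewrite -msupp_constant -eq_gh msupp_constant set11.
Qed.

Lemma card_zsf_meet1 (S : mseq n m) : S \in zsf_set n m 1 ->
  (#|[set T in zsf_set n m 1 | ~~ [disjoint msupp S & msupp T]]| <= 1)%N.
Proof.
move=> /constant_zsf[g _ ->]; rewrite -[X in (_ <= X)%N](cards1 (constant_mseq g)).
apply/subset_leq_card/fintype.subsetP => T; rewrite inE => /andP[ZT].
have [h _ ->] := constant_zsf ZT.
by rewrite !msupp_constant disjoints1 inE negbK inE => /eqP ->.
Qed.

End SingleElement.

Lemma num_generators_gt0 n : (1 < n)%N -> (0 < num_generators n)%N.
Proof.
by move=> n1; apply/card_gt0P; exists 1; rewrite inE generator_unit // unitr1.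
Qed.

Lemma num_zsfE n m d (A : {set 'Z_n}) :
  num_zsf m d A = #|[set S in zsf_set n m d | msupp S \subset A]|.
Proof. by apply: eq_card => S; rewrite !inE -!andbA. Qed.

Lemma prob_subset_le1 (R : realType) n (p : R) (E : pred {set 'Z_n}) :
  0 <= p <= 1 -> prob_subset p E <= 1.
Proof.
move=> p01; have /andP[p0 p1] := p01; rewrite -(@prob_subsetT R n p).
rewrite /prob_subset [leLHS]big_mkcond; apply: ler_sum => A _.
by case: ifP => // _; rewrite mulr_ge0 ?exprn_ge0 ?subr_ge0.
Qed.

(** * Passage to the limit *)

Local Open Scope classical_set_scope.

Lemma aas_of_bound (R : realType) (p : nat -> R) (E : forall n, pred {set 'Z_n})
    (e : nat -> R) :
  (forall n, 0 <= p n <= 1) -> e n @[n --> \oo] --> (0 : R) ->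
  (\forall n \near \oo, 1 - e n <= prob_subset (p n) (E n)) -> aas p E.
Proof.
move=> p01 e0 le_e; rewrite /aas.
apply: (@squeeze_cvgr _ _ _ _ (fun n => 1 - e n) (fun=> 1)).
- by near=> n; rewrite prob_subset_le1 // andbT; near: n.
- by rewrite -[X in _ --> X]subr0; apply: cvgB => //; apply: cvg_cst.
- exact: cvg_cst.
Unshelve. all: by end_near. Qed.

Lemma cvg_ln_nat (R : realType) : (ln n%:R : R) @[n --> \oo] --> +oo.
Proof.
apply/cvgryPge => A; have /cvgryPge/(_ (expR A)) := @cvgr_idn R.
apply: filterS => n le_n; rewrite -[A]expRK ler_ln ?posrE ?expR_gt0 //.
exact: lt_le_trans (expR_gt0 A) le_n.
Qed.

Lemma cvgV_sqr (R : realType) (u : nat -> R) :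
  u n @[n --> \oo] --> +oo -> (u n ^+ 2)^-1 @[n --> \oo] --> (0 : R).
Proof.
move=> uoo.
have u0 : (u n)^-1 @[n --> \oo] --> (0 : R).
  apply/gtr0_cvgV0 => //; by move/cvgryPgt : uoo => /(_ 0).
rewrite -[X in _ --> X](mulr0 0); under eq_fun do rewrite expr2 invfM.
exact: cvgM.
Qed.

Section AsymptoticStatements.
Variables (R : realType) (p : nat -> R).
Hypothesis p01 : forall n, 0 <= p n <= 1.
Hypothesis p_neq0 : \forall n \near \oo, p n != 0.

(** Different constant sequences have disjoint supports, so [C = 1] and the failure probability is
    at most [1 / w ^ 2]. *)
Lemma aas_num_zsf1 (k : nat -> nat) (w : nat -> R) :
  (\forall n \near \oo, (k n <= n %/ 3)%N) -> w n @[n --> \oo] --> +oo ->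
  aas p (fun (n : nat) (A : {set 'Z_n}) =>
    let mu := p n * (num_generators n)%:R in
    mu - w n * Num.sqrt mu <= (num_zsf (n - 1 - k n) 1 A)%:R
                           <= mu + w n * Num.sqrt mu).
Proof.
move=> le_k woo; apply: (@aas_of_bound _ _ _ (fun n => (w n ^+ 2)^-1)) => //.
  exact: cvgV_sqr.
have wgt0 : \forall n \near \oo, 0 < w n by move/cvgryPgt : woo => /(_ 0).
(* From 6 on, [k <= n / 3] implies [n <= 2 * (n - 1 - k)]. *)
near=> n; have n6 : (6 <= n)%N by near: n; exact: nbhs_infty_ge.
have le_kn : (k n <= n %/ 3)%N by near: n.
have n1 : (1 < n)%N by lia.
have lt_mn : (n - 1 - k n < n)%N by lia.
have le_n2m : (n <= 2 * (n - 1 - k n))%N by lia.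
have wn : 0 < w n by near: n.
have pn : 0 < p n by rewrite lt0r (andP (p01 n)).1 andbT; near: n.
set mu := p n * _.
have mu_gt0 : 0 < mu by rewrite mulr_gt0 // ltr0n num_generators_gt0.
have c_gt0 : 0 < w n * Num.sqrt mu by rewrite mulr_gt0 // sqrtr_gt0.
have := @concentration_family R n (p n) (p01 n) _ (zsf_set n (n - 1 - k n) 1)
  (@msupp n _) 1 1 _ (card_zsf_meet1 n1 lt_mn le_n2m) _ c_gt0.
rewrite card_zsf_set1 // expr1 mul1r -/mu exprMn sqr_sqrtr ?(ltW mu_gt0) //.
rewrite invfM mulrCA mulfV ?gt_eqF // mulr1 => prob_ge.
apply: le_trans (prob_ge _) _.
  by move=> S; rewrite inE => /and3P[_ _ /eqP].
by rewrite le_eqVlt; apply/orP; left; apply/eqP/eq_bigl => A; rewrite num_zsfE ler_distl.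
Unshelve. all: by end_near. Qed.

(** The variance is at most [C * Q * mu], so the failure probability is at most
    [C * Q / ln n ^ (2 d)]. The logarithm absorbs [C] and [Q], which depend on [k] and [d] only;
    once [ln n >= 1], the exponent is lowered to 2. *)
Lemma aas_num_zsf k d : (2 <= d)%N ->
  aas p (fun (n : nat) (A : {set 'Z_n}) =>
    let mu := p n ^+ d * (num_generators n)%:R in
    `| (num_zsf (n - 1 - k) d A)%:R
       - mu * (\sum_((d.-1 * d) %/ 2 <= j < k.+1) q j d.-1)%:R |
    <= 1 * (Num.sqrt mu * ln n%:R ^+ d)).
Proof.
case: d => [//|d] d_gt0; rewrite ltnS in d_gt0; rewrite -[d.+1.-1]/d.
rewrite [X in X%:R](card_part_mults k d).
set C := (d.+1 * #|{: 'I_k.+2 * 'I_k.+2 * {ffun 'I_k -> 'I_k.+1}}|)%N.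
set Q := #|part_mults k d|.
have ln_oo := @cvg_ln_nat R.
apply: (@aas_of_bound _ _ _ (fun n => (C * Q)%:R * (ln n%:R ^+ 2)^-1)) => //.
  rewrite -[X in _ --> X](mulr0 (C * Q)%:R); apply: cvgM; first exact: cvg_cst.
  exact: cvgV_sqr.
have ln_ge1 : \forall n \near \oo, 1 <= ln n%:R :> R by move/cvgryPge : ln_oo => /(_ 1).
near=> n; have lt_kn : (8 * k + 4 < n)%N by near: n; exact: nbhs_infty_gt.
have n1 : (1 < n)%N by lia.
have ln1 : 1 <= ln n%:R :> R by near: n.
have ln0 : 0 < ln n%:R :> R := lt_le_trans ltr01 ln1.
have pn : 0 < p n by rewrite lt0r (andP (p01 n)).1 andbT; near: n.
set mu := p n ^+ _ * _.
have mu_gt0 : 0 < mu by rewrite mulr_gt0 ?exprn_gt0 // ltr0n num_generators_gt0.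
have c_gt0 : 0 < 1 * (Num.sqrt mu * ln n%:R ^+ d.+1).
  by rewrite mul1r mulr_gt0 ?sqrtr_gt0 ?exprn_gt0.
have := @concentration_family R n (p n) (p01 n) _ (zsf_set n (n - 1 - k) d.+1)
  (@msupp n _) d.+1 C _ (@card_zsf_meet k n lt_kn d) _ c_gt0.
have muE : p n ^+ d.+1 * (num_generators n * Q)%:R = mu * Q%:R by rewrite natrM mulrA.
rewrite card_zsf_set // -/Q muE => prob_ge.
apply: le_trans (le_trans _ (prob_ge _)) _.
- rewrite lerD2l lerN2 mul1r exprMn sqr_sqrtr ?(ltW mu_gt0) // invfM.
  have -> : C%:R * (mu * Q%:R) * (mu^-1 * (ln n%:R ^+ d.+1 ^+ 2)^-1) =
      (C * Q)%:R * (ln n%:R ^+ d.+1 ^+ 2)^-1.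
    by rewrite natrM; field; rewrite ?expf_neq0 ?(gt_eqF ln0) ?(gt_eqF mu_gt0).
  rewrite ler_wpM2l // lef_pV2 ?posrE ?exprn_gt0 // -exprM.
  by rewrite ler_weXn2l //; lia.
- by move=> S; rewrite inE => /and3P[_ _ /eqP].
- by rewrite le_eqVlt; apply/orP; left; apply/eqP/eq_bigl => A; rewrite num_zsfE.
Unshelve. all: by end_near. Qed.

End AsymptoticStatements.

Local Open Scope ring_scope.

Theorem theorem5 (R : realType) :
  (forall (p : nat -> R) (k : nat -> nat) (w : nat -> R),
     (forall n : nat, 0 <= p n <= 1) ->
     (\forall n \near \oo, (k n <= n %/ 3)%N) ->
     negligible_wrt (fun n : nat => ln (ln n%:R) / n%:R) p ->
     w n @[n --> \oo] --> +oo ->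
     aas p (fun (n : nat) (A : {set 'Z_n}) =>
       let mu := p n * (num_generators n)%:R in
       mu - w n * Num.sqrt mu <= (num_zsf (n - 1 - k n) 1 A)%:R
                              <= mu + w n * Num.sqrt mu))
  /\
  (forall k : nat, exists c : R, forall (d : nat) (p : nat -> R),
     (2 <= d)%N ->
     (forall n : nat, 0 <= p n <= 1) ->
     negligible_wrt
       (fun n : nat =>
          ln n%:R ^+ 2 * (ln (ln n%:R) `^ d%:R^-1) / (n%:R `^ d%:R^-1)) p ->
     aas p (fun (n : nat) (A : {set 'Z_n}) =>
       let mu := p n ^+ d * (num_generators n)%:R in
       `| (num_zsf (n - 1 - k) d A)%:R
          - mu * (\sum_((d.-1 * d) %/ 2 <= j < k.+1) q j d.-1)%:R |
       <= c * (Num.sqrt mu * ln n%:R ^+ d))).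
Proof.
split.
  move=> p k w p01 le_k [p_neq0 _] woo; exact: aas_num_zsf1.
move=> k; exists 1 => d p d_ge2 p01 [p_neq0 _]; exact: aas_num_zsf.
Qed.
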